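(* Let $a,b$ be integers with $a+b\ge2$ and $a\ne b$. For $n\ge1$ let $\chi^{ab}_n(q)$ be the characteristic polynomial of the truncated affine arrangement $\mathcal{A}^{ab}_{n-1}$ in $V_{n-1}=\{x\in\mathbb{R}^n:\sum x_i=0\}$ given by $x_i-x_j=-a+1,-a+2,\dots,b-1$, $1\le i<j\le n$. Then all roots of $\chi^{ab}_n(q)$ have real part equal to $(a+b-1)n/2$, and the roots are symmetric with respect to the point $(a+b-1)n/2$ (i.e. the multiset of roots is invariant under $q\mapsto (a+b-1)n-q$).
   Context: The characteristic polynomial of an arrangement $\mathcal{A}$ in $V$ is $\chi_{\mathcal{A}}(q)=\sum_{z}\mu(\hat0,z)q^{\dim z}$, the sum over the intersection poset (nonempty intersections of hyperplanes, including $V=\hat0$, ordered by reverse inclusion), $\mu$ its Möbius function.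
   Formalization: The formal theorem also assumes a ≥ 0 and b ≥ 0; for negative parameters the claim can fail: a=-1, b=4, n=4 gives q^3-12q^2+60q-116, which is -4 at the point q=4, so the real root is not 4. *)

(* Defs.v *)
From HB Require Import structures.
From mathcomp Require Import all_boot all_order all_algebra finmap.
From mathcomp Require Import boolp classical_sets cardinality reals.
From mathcomp.real_closed Require Import complex.
From mathcomp Require Import zify.

Set Implicit Arguments.
Unset Strict Implicit.
Unset Printing Implicit Defensive.

Import Order.TTheory GRing.Theory Num.Theory.
Local Open Scope classical_set_scope.
Local Open Scope ring_scope.

(* The recursion depth of [mobius] is bounded by the length of a chain in P;
   [mobius_refl] and [mobiusE] give the defining recursion. *)
Fixpoint mobius_rec d (T : porderType d) (P : {fset T}) (k : nat) (x z : T)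
    : int :=
  if k is k'.+1 then
    if x == z then 1
    else - \sum_(y <- P | (x <= y < z)%O) mobius_rec P k' x y
  else 0.

Definition mobius d (T : porderType d) (P : {fset T}) (x z : T) : int :=
  mobius_rec P #|` P| x z.

Section MobiusTheory.
Context d (T : porderType d) (P : {fset T}).
Implicit Types x y z : T.

Lemma mobius_refl x : x \in P -> mobius P x x = 1.
Proof.
rewrite /mobius => xP; have : (0 < #|` P|)%N by rewrite cardfs_gt0; apply/fset0Pn; exists x.
by case: #|` P| => //= k _; rewrite eqxx.
Qed.

Let below z : {fset T} := [fset y in P | (y <= z)%O]%fset.

Let below_lt y z : z \in P -> (y < z)%O -> (#|` below y| < #|` below z|)%N.
Proof.
move=> zP yz; apply: fproper_ltn_card; rewrite fproperEneq; apply/andP; split.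
  apply/eqP => /fsetP/(_ z); rewrite !inE zP lexx /= => zy.
  have {}zy : (z <= y)%O by rewrite zy.
  by have := lt_le_trans yz zy; rewrite ltxx.
apply/fsubsetP => w; rewrite !inE => /andP[-> wy] /=.
exact: le_trans wy (ltW yz).
Qed.

Let mobius_rec_fuel k l x z : z \in P ->
  (#|` below z| <= k)%N -> (#|` below z| <= l)%N ->
  mobius_rec P k x z = mobius_rec P l x z.
Proof.
elim: k l z => [|k IH] l z zP.
  rewrite leqn0 cardfs_eq0 => /eqP /fsetP /(_ z).
  by rewrite !inE zP lexx.
case: l => [|l].
  by move=> _; rewrite leqn0 cardfs_eq0 => /eqP /fsetP /(_ z); rewrite !inE zP lexx.
move=> zk zl /=; case: eqP => // _; congr (- _).
rewrite big_seq_cond [RHS]big_seq_cond; apply: eq_bigr => y /andP[yP /andP[_ yz]].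
have lt := below_lt zP yz.
by apply: IH => //; rewrite -ltnS; apply: leq_trans lt _.
Qed.

Lemma mobiusE x z : z \in P -> x != z ->
  mobius P x z = - \sum_(y <- P | (x <= y < z)%O) mobius P x y.
Proof.
move=> zP xz; rewrite /mobius.
have cP y : (#|` below y| <= #|` P|)%N.
  by apply: fsubset_leq_card; apply/fsubsetP => w; rewrite !inE => /andP[].
rewrite (@mobius_rec_fuel _ #|` P|.+1) //; last by rewrite ltnW // ltnS cP.
rewrite /= (negPf xz); congr (- _).
Qed.

End MobiusTheory.

Section Arrangement.
Context (R : realType) (vT : vectType R).

Definition translate (x : vT) (U : {vspace vT}) : set vT :=
  [set y | y - x \in U].

(* Meaningful only for translates of subspaces, see [aff_dim_translate]. *)
Definition aff_dim (F : set vT) : nat :=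
  xget 0%N [set m | exists x U, F = translate x U /\ m = \dim U].

Lemma aff_dim_translate x U : aff_dim (translate x U) = \dim U.
Proof.
rewrite /aff_dim; case: xgetP => [m _ [y [W [eqF ->]]]|/(_ (\dim U))]; last first.
  by move=> h; exfalso; apply: h; exists x, U.
have mem z : (z - x \in U) = (z - y \in W).
  by apply/idP/idP; have /= := congr1 (@^~ z) eqF; rewrite /translate /= => ->.
have yU : y - x \in U by rewrite mem subrr mem0v.
suff -> : W = U by [].
apply/vspaceP => w.
have := mem (w + y); rewrite addrK => <-.
by rewrite -addrA rpredDr.
Qed.

(* An arrangement is a set A of subsets (the hyperplanes) of the ambient
   space V; the empty subfamily contributes V itself. *)
Definition flats (V : {vspace vT}) (A : set (set vT)) : set (set vT) :=
  [set F | F !=set0 /\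
    exists2 B, B `<=` A & F = [set` V] `&` \bigcap_(H in B) H].

Lemma finite_flats V A : finite_set A -> finite_set (flats V A).
Proof.
move=> finA.
apply: (@sub_finite_set _ _
  ((fun X : {fset set vT} => [set` V] `&` \bigcap_(H in [set` X]) H) @`
   [set` fpowerset (fset_set A)])); last by apply: finite_image.
move=> F [_ [B BA ->]]; have finB := sub_finite_set BA finA.
exists (fset_set B); last by rewrite fset_setK.
by rewrite /= fpowersetE -fset_set_sub.
Qed.

(* [^d] reverses the inclusion order on sets.  [fset_set] enumerates a finite
   set, and is empty on an infinite one. *)
Definition intersection_poset (V : {vspace vT}) (A : set (set vT))
    : {fset (set vT)^d} :=
  fset_set (flats V A : set (set vT)^d).

Lemma mem_intersection_poset V A (F : set vT) : finite_set A ->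
  reflect (flats V A F) (F \in intersection_poset V A).
Proof.
move=> finA; apply: (iffP idP) => h.
  by move: h; rewrite in_fset_set ?inE //; exact: finite_flats.
by rewrite in_fset_set ?inE //; exact: finite_flats.
Qed.

Lemma le_intersection_poset (F G : (set vT)^d) :
  (F <= G)%O <-> (G : set vT) `<=` F.
Proof. by rewrite leEdual subsetEset. Qed.

Definition arr_char_poly (V : {vspace vT}) (A : set (set vT)) : {poly int} :=
  \sum_(z <- intersection_poset V A)
    mobius (intersection_poset V A) ([set` V] : (set vT)^d) z *: 'X^(aff_dim z).

End Arrangement.

Section Truncated.
Context (R : realType) (n : nat).

Definition coord_sum (x : 'rV[R]_n) : R^o := \sum_i x 0 i.

Definition sum0_space : {vspace 'rV[R]_n} := lker (linfun coord_sum).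

Lemma mem_sum0_space x : (x \in sum0_space) = (\sum_i x 0 i == 0).
Proof.
have lin : linear coord_sum.
  move=> c u v; rewrite /coord_sum scaler_sumr -big_split /=.
  by apply: eq_bigr => i _; rewrite !mxE.
pose f : {linear 'rV[R]_n -> R^o} := HB.pack coord_sum
  (GRing.isLinear.Build _ _ _ _ coord_sum lin).
by rewrite memv_ker -[coord_sum]/(f : _ -> _) lfunE.
Qed.

Definition diff_hyperplane (i j : 'I_n) (k : int) : set 'rV[R]_n :=
  [set x | x \in sum0_space /\ x 0 i - x 0 j = k%:~R].

Definition truncated_arrangement (a b : int) : set (set 'rV[R]_n) :=
  [set H | exists i j : 'I_n, exists k : int,
    [/\ (i < j)%N, - a + 1 <= k, k <= b - 1 & H = diff_hyperplane i j k]].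

Lemma finite_truncated_arrangement a b : finite_set (truncated_arrangement a b).
Proof.
pose f (t : 'I_n * 'I_n * 'I_(absz (a + b)%R).+1) :=
  diff_hyperplane t.1.1 t.1.2 (- a + 1 + (t.2 : nat)%:Z).
apply: (@sub_finite_set _ _ (f @` setT)); last first.
  by apply: finite_image; exact: finite_finset.
move=> H [i [j [k [_ ak kb ->]]]].
have mlt : (absz (k + a - 1)%R < (absz (a + b)%R).+1)%N by lia.
exists (i, j, Ordinal mlt) => //; rewrite /f /=.
by congr diff_hyperplane; lia.
Qed.

Definition trunc_char_poly (a b : int) : {poly int} :=
  arr_char_poly sum0_space (truncated_arrangement a b).

End Truncated.

(* Main.v *)
From HB Require Import structures.
Require Import Defs.
From mathcomp Require Import all_boot all_order all_algebra perm finmap.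
From mathcomp Require Import boolp classical_sets cardinality reals.
From mathcomp.real_closed Require Import complex.
From mathcomp Require Import zify ring lra.
Import Order.TTheory GRing.Theory Num.Theory.
Local Open Scope ring_scope.

(** For q large, Moebius inversion over the intersection poset identifies
  q * chi(q) with the number of x in (Z/q)^n with x_i - x_j outside
  {-a+1,...,b-1} mod q for all i < j: a point x mod q can be cut open into
  integers at a large gap, so the equations it satisfies define a real flat,
  and a flat of dimension d contains q^(d+1) points mod q.

  Reversing the coordinates, assume a < b and put k = b - a.  Read cyclically,
  such an x with x_0 = 0 is a word s (a permutation) whose gaps are at least a
  after an ascent and at least b = a + k after a descent.  Writing a gap as
  a + r + k h with 0 <= r < k turns this into the condition h >= 0 or h >= 1,
  which is the case (a,b) = (0,1), where every x is allowed.  Hence chi(q) is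
  the sum of ((q - an - |r|) / k)^(n-1) over the r in [0,k)^n for which k
  divides q - an - |r|.  The residue of |r| mod k is equidistributed even after
  weighting by |r|^m with m < n, so that, S being the shift f(q) -> f(q-1),
    k^n chi(q) = S^(an) (1 + S + ... + S^(k-1))^n q^(n-1)
  (Postnikov-Stanley).  Finally 1 + S + ... + S^(k-1) is a product of factors
  S - w with |w| = 1 and w <> 1, and each of them moves polynomials with all
  roots on Re = c to polynomials with all roots on Re = c + 1/2.  The symmetry
  holds because chi is real and N - z is the conjugate of z on the line
  Re z = N/2. *)

(** * Sums over r in [0,k)^n *)

(** When [F j] is the shift of a polynomial by [j], this is the n-th power of the operator 1 + S +
    ... + S^(k-1). *)
Fixpoint residue_sum (k : nat) (V : zmodType) (n : nat) (F : nat -> V) : V :=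
  if n is n'.+1 then \sum_(t < k) residue_sum k V n' (fun j => F (t + j)%N)
  else F 0%N.
Arguments residue_sum k {V} n F.

Lemma eq_residue_sum k (V : zmodType) n (F G : nat -> V) :
  (forall j, (j <= n * k)%N -> F j = G j) -> residue_sum k n F = residue_sum k n G.
Proof.
elim: n F G => [|n IH] F G FG /=; first exact: FG.
apply: eq_bigr => t _; apply: IH => j jn; apply: FG; rewrite mulSn leq_add //.
exact: ltnW (ltn_ord t).
Qed.

Lemma residue_sum_morph k (V W : zmodType) (h : {additive V -> W}) n F :
  residue_sum k n (fun j => h (F j)) = h (residue_sum k n F).
Proof.
elim: n F => [|n IH] F //=; rewrite raddf_sum; apply: eq_bigr => t _; exact: IH.
Qed.

Lemma residue_sum_sum k (V : zmodType) I (s : seq I) (P : pred I) n (F : I -> nat -> V) :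
  residue_sum k n (fun j => \sum_(i <- s | P i) F i j) =
  \sum_(i <- s | P i) residue_sum k n (F i).
Proof.
elim: n F => [|n IH] F //=; rewrite exchange_big /=.
by apply: eq_bigr => t _; rewrite IH.
Qed.

Lemma residue_sum_mull k (F : pzRingType) n (c : F) (G : nat -> F) :
  residue_sum k n (fun j => c * G j) = c * residue_sum k n G.
Proof.
elim: n G => [|n IH] G //=; rewrite mulr_sumr; apply: eq_bigr => t _; exact: IH.
Qed.

Lemma eq_mod_shift k t j r : (t < k)%N ->
  (t + j == r %[mod k]) = (j == r + (k - t) %[mod k])%N.
Proof.
move=> tk; rewrite -[in RHS](eqn_modDl t).
by rewrite addnCA subnKC ?(ltnW tk) // [in RHS]modnDr.
Qed.

(** As t runs over [0,k), t + j meets every class mod k exactly once. *)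
Lemma sum_mod_class k (V : zmodType) (v : V) j r : (0 < k)%N ->
  \sum_(t < k) (if (t + j == r %[mod k])%N then v else 0) = v.
Proof.
move=> k0; rewrite -big_mkcond /=.
have t0k : ((r + (k - j %% k)) %% k < k)%N by rewrite ltn_mod.
rewrite (big_pred1 (Ordinal t0k)) // => t.
by rewrite -modnDmr addnC eq_mod_shift ?ltn_mod // (modn_small (ltn_ord t)).
Qed.

(* A sum of r_1,...,r_n uniform in [0,k) has equidistributed residue given any
   moment of order m < n: each monomial of the m-th power misses some r_i. *)
Lemma residue_sum_class k n m (F : comNzRingType) (z : F) r :
  (0 < k)%N -> (m < n)%N ->
  k%:R * residue_sum k n
    (fun j => if (j == r %[mod k])%N then (z - j%:R) ^+ m else 0) =
  residue_sum k n (fun j => (z - j%:R) ^+ m).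
Proof.
move=> k0; elim: n m r => // n IH m r mn /=.
pose co (t : 'I_k) i : F := (- t%:R) ^+ i *+ 'C(m, i).
have E (t : 'I_k) (B : pred nat) : residue_sum k n (fun j =>
      if B j then (z - (t + j)%:R) ^+ m else 0) =
    \sum_(i < m.+1) co t i *
      residue_sum k n (fun j => if B j then (z - j%:R) ^+ (m - i) else 0).
  under [RHS]eq_bigr do rewrite -residue_sum_mull.
  rewrite -residue_sum_sum; apply: eq_residue_sum => j _.
  case: (B j); last by rewrite big1 // => i _; rewrite mulr0.
  rewrite (_ : z - _ = (z - j%:R) + (- t%:R)); last by rewrite natrD; ring.
  rewrite exprDn; apply: eq_bigr => i _; rewrite /co mulrnAl; congr (_ *+ _).
  by rewrite mulrC.
have E1 (t : 'I_k) := E t predT.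
rewrite (eq_bigr _ (fun t _ => E t (fun j => (t + j == r %[mod k])%N))).
rewrite (eq_bigr _ (fun t _ => E1 t)).
under eq_bigr do rewrite big_ord_recl.
under [RHS]eq_bigr do rewrite big_ord_recl.
(* In the i = 0 terms t occurs only in the residue condition, which the sum over t removes; for i >
   0 the exponent drops below n and the induction hypothesis applies. *)
rewrite !big_split /= mulrDr; congr (_ + _).
  have co0 t : co t 0%N = 1 by rewrite /co bin0 mulr1n expr0.
  under eq_bigr do rewrite co0 mul1r.
  under [RHS]eq_bigr do rewrite co0 mul1r.
  rewrite -residue_sum_sum mulr_natl.
  rewrite sumr_const card_ord; congr (_ *+ _).
  by apply: eq_residue_sum => j _; rewrite sum_mod_class.
rewrite mulr_sumr; apply: eq_bigr => t _; rewrite mulr_sumr.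
apply: eq_bigr => i _; rewrite mulrCA; congr (_ * _).
have mi : (m - bump 0 i < n)%N by rewrite /bump; have := ltn_ord i; lia.
rewrite -(IH _ (r + (k - t))%N mi); congr (_ * _).
by apply: eq_residue_sum => j _; rewrite eq_mod_shift.
Qed.

(** * Shift operators and roots *)

Lemma comp_poly_shiftD (F : comNzRingType) (f : {poly F}) (l m : nat) :
  (f \Po ('X - m%:R)) \Po ('X - l%:R) = f \Po ('X - (l + m)%:R).
Proof.
rewrite -comp_polyA comp_polyB comp_polyX -[m%:R]polyC_natr comp_polyC polyC_natr.
by rewrite natrD opprD addrA.
Qed.

Section Roots.
Context (R : realType).
Implicit Types (f g : {poly R[i]}) (c : R) (z w : R[i]).

Definition roots_on_line c f := forall z, root f z -> complex.Re z = c.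

(** The operator S - w. *)
Definition shift_sub w f := f \Po ('X - 1) - w *: f.

Lemma normc_lt z w : complex.Im z = complex.Im w ->
  complex.Re z ^+ 2 < complex.Re w ^+ 2 -> `|z| < `|w|.
Proof.
case: z w => [x y] [x' y'] /= -> h; rewrite !normc_def /= ltcR.
by rewrite ltr_sqrt ?ltrD2r //; apply: ltr_wpDr (le_lt_trans _ h); rewrite sqr_ge0.
Qed.

Lemma prod_norm_lt (rs : seq R[i]) (F G : R[i] -> R[i]) :
  rs != [::] -> {in rs, forall r, `|F r| < `|G r|} ->
  `|\prod_(r <- rs) F r| < `|\prod_(r <- rs) G r|.
Proof.
elim: rs => // r [|r' rs] IH _ h; first by rewrite !big_seq1 h ?mem_head.
rewrite big_cons [X in _ < `|X|]big_cons !normrM ltr_pM ?normr_ge0 ?h ?mem_head //.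
by apply: IH => // u ur; apply: h; rewrite inE ur orbT.
Qed.

(* All roots of f having the same real part, |f(z-1)| and |f(z)| compare the
   way the distances of z-1 and z to the line do. *)
Lemma shift_sub_neq0 w c f z : `|w| = 1 -> w != 1 -> f != 0 ->
  roots_on_line c f -> complex.Re z != c + 1 / 2 -> (shift_sub w f).[z] != 0.
Proof.
move=> w1 wn1 f0 fc zc; rewrite !hornerE horner_comp !hornerE subr_eq0.
have [rs fE] := closed_field_poly_normal f.
have l0 : lead_coef f != 0 by rewrite lead_coef_eq0.
have rsc r : r \in rs -> complex.Re r = c.
  by move=> rin; apply: fc; rewrite fE rootZ // root_prod_XsubC.
(* A constant [f] offers no distances to compare; there w <> 1 gives the claim. *)
have [rs0|rs0] := eqVneq rs [::].
  move: fE; rewrite rs0 big_nil alg_polyC => ->; rewrite !hornerC; apply/eqP => e.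
  have /eqP : (1 - w) * lead_coef f = 0 by rewrite mulrBl mul1r {1}e subrr.
  by rewrite mulf_eq0 (negPf l0) orbF subr_eq0 eq_sym (negPf wn1).
apply/eqP => /(congr1 Num.norm); rewrite normrM w1 mul1r fE !hornerZ !normrM.
move/(mulfI (_ : `|lead_coef f| != 0)); rewrite normr_eq0 => /(_ l0).
rewrite !horner_prod; under eq_bigr do rewrite !hornerE.
under [X in _ = `|X|]eq_bigr do rewrite !hornerE.
move=> e.
suff : (`|\prod_(r <- rs) (z - 1 - r)| < `|\prod_(r <- rs) (z - r)|) ||
       (`|\prod_(r <- rs) (z - r)| < `|\prod_(r <- rs) (z - 1 - r)|).
  by rewrite e ltxx.
apply/orP.
(* For every root r, |z - 1 - r|^2 - |z - r|^2 = 1 - 2 (Re z - c), so all factors compare the same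
   way. *)
have [lt|gt|e'] := ltgtP (complex.Re z) (c + 1 / 2); last by rewrite e' eqxx in zc.
- right; apply: prod_norm_lt => // r /rsc rc; apply: normc_lt.
    by case: z {e zc lt} r {rc} => ? ? [? ?] /=; rewrite subr0.
  case: z {e zc} lt r rc => x y /= lt [u v] /= ->.
  by nra.
- left; apply: prod_norm_lt => // r /rsc rc; apply: normc_lt.
    by case: z {e zc gt} r {rc} => ? ? [? ?] /=; rewrite subr0.
  case: z {e zc} gt r rc => x y /= lt [u v] /= ->.
  by nra.
Qed.

Lemma shift_sub_line w c f : `|w| = 1 -> w != 1 -> f != 0 ->
  roots_on_line c f ->
  shift_sub w f != 0 /\ roots_on_line (c + 1 / 2) (shift_sub w f).
Proof.
move=> w1 wn1 f0 fc; split; last first.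
  move=> z /rootP z0; have [//|zc] := eqVneq (complex.Re z) (c + 1 / 2).
  by have := shift_sub_neq0 w c f z w1 wn1 f0 fc zc; rewrite z0 eqxx.
(* Any point off the new line shows that the polynomial is nonzero. *)
have zc : complex.Re ((c + 3 / 2) +i* 0)%C != c + 1 / 2.
  by rewrite /= ; apply/eqP; lra.
have := shift_sub_neq0 _ _ _ _ w1 wn1 f0 fc zc.
by apply: contraNneq => ->; rewrite horner0.
Qed.

(** This is g(S) applied to f as soon as N is at least [size g]. *)
Definition shift_action N g f := \sum_(i < N) g`_i *: (f \Po ('X - i%:R)).

Lemma shift_action_mulXsubC N w g f : (size g <= N)%N ->
  shift_action N.+1 (('X - w%:P) * g) f = shift_sub w (shift_action N g f).
Proof.
move=> gN; rewrite /shift_action /shift_sub.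
under eq_bigr do rewrite mulrBl coefB coefXM coefCM scalerBl.
rewrite big_split /= big_ord_recl /= scale0r add0r; congr (_ + _).
  rewrite raddf_sum /=; apply: eq_bigr => i _.
  by rewrite comp_polyZ -[1]/(1%:R) comp_poly_shiftD.
rewrite sumrN big_ord_recr /= (nth_default _ gN) mulr0 scale0r addr0 scaler_sumr.
by congr (- _); apply: eq_bigr => i _; rewrite scalerA.
Qed.

Lemma shift_action_line N (ws : seq R[i]) c f : (size ws < N)%N ->
  {in ws, forall w, `|w| = 1 /\ w != 1} -> f != 0 -> roots_on_line c f ->
  let h := shift_action N (\prod_(w <- ws) ('X - w%:P)) f in
  h != 0 /\ roots_on_line (c + (size ws)%:R / 2) h.
Proof.
move=> + + f0 fc; elim: ws N => [|w ws IH] [|N] // sN H /=.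
  rewrite big_nil /shift_action big_ord_recl big1 ?addr0 => [|i _]; last first.
    by rewrite coefC /= scale0r.
  by rewrite coefC /= scale1r subr0 comp_polyXr mul0r addr0.
rewrite big_cons shift_action_mulXsubC ?size_prod_XsubC //.
have [u|h0 hc] := IH N sN; first by move=> uin; apply: H; rewrite inE uin orbT.
have [w1 wn1] := H w (mem_head _ _).
have [] := shift_sub_line _ _ _ w1 wn1 h0 hc; split => //.
by rewrite -natr1 mulrDl addrA.
Qed.

(** The polynomial 1 + X + ... + X^(k-1) divides X^k - 1 and takes the value k at 1, so its k - 1
    roots have modulus 1 and differ from 1; each moves the line by 1/2. *)
Lemma sum_shift_line k c f : (0 < k)%N -> f != 0 -> roots_on_line c f ->
  let h := \sum_(t < k) (f \Po ('X - t%:R)) in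
  h != 0 /\ roots_on_line (c + k.-1%:R / 2) h.
Proof.
case: k => // k _ f0 fc /=.
pose g : {poly R[i]} := \poly_(i < k.+1) 1.
have sg : size g = k.+1 by rewrite size_poly_eq // oner_eq0.
have [ws gE] := closed_field_poly_normal g.
have lg : lead_coef g = 1 by rewrite lead_coefE sg coef_poly ltnSn.
have {}gE : g = \prod_(w <- ws) ('X - w%:P) by rewrite gE lg scale1r.
have sws : size ws = k by have := sg; rewrite gE size_prod_XsubC => -[].
have H : {in ws, forall w, `|w| = 1 /\ w != 1}.
  move=> w; rewrite -root_prod_XsubC -gE => /rootP gw.
  have gwE : g.[w] = \sum_(i < k.+1) w ^+ i.
    by rewrite horner_poly; apply: eq_bigr => i _; rewrite mul1r.
  split; last first.
    apply: contraTneq (_ : g.[w] == 0) => [w1|]; last by rewrite gw.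
    rewrite gwE w1; under eq_bigr do rewrite expr1n.
    by rewrite sumr_const card_ord pnatr_eq0.
  have /(congr1 Num.norm)/eqP := subrX1 w k.+1.
  rewrite -gwE gw mulr0 normr0 normr_eq0 subr_eq0 => /eqP/(congr1 Num.norm).
  rewrite normrX normr1 => /eqP; rewrite pexpr_eq1 ?normr_ge0 //.
  by move/eqP.
have := shift_action_line k.+1 ws c f _ H f0 fc.
rewrite -gE sws ltnSn /shift_action => /(_ isT) /=.
by under eq_bigr => i _ do rewrite coef_poly ltn_ord scale1r.
Qed.

End Roots.

Lemma residue_sum_line (R : realType) k n c (f : {poly R[i]}) :
  (0 < k)%N -> f != 0 -> roots_on_line R c f ->
  let h := residue_sum k n (fun j => f \Po ('X - j%:R)) in
  h != 0 /\ roots_on_line R (c + (n * k.-1)%:R / 2) h.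
Proof.
move=> k0; elim: n c f => [|n IH] c f f0 fc /=.
  by rewrite subr0 comp_polyXr mul0r addr0.
have [h0 hc] := sum_shift_line R k c f k0 f0 fc.
have := IH _ _ h0 hc; rewrite mulSn natrD mulrDl addrA /=.
(* Shifts add up, so the outermost sum may equally well be applied to [f] first. *)
set p := residue_sum _ _ _; set q := \sum_(t < k) _; suff -> : p = q by [].
rewrite /q -residue_sum_sum; apply: eq_residue_sum => j _.
rewrite raddf_sum /=; apply: eq_bigr => t _.
by rewrite comp_poly_shiftD addnC.
Qed.

(** * Counting gap sequences *)

Section GapCount.
Local Open Scope nat_scope.

(** The number of (g_0, ..., g_(n-1)) with sum [Q] and [g_t >= c t]; [l] is what remains of [Q]
    after the first gap. *)
Fixpoint gap_count n (c : nat -> nat) Q :=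
  if n is n'.+1 then
    \sum_(l < Q.+1 | c 0 + l <= Q) gap_count n' (fun t => c t.+1) l
  else (Q == 0) : nat.

Lemma eq_gap_count n c c' Q : (forall t, t < n -> c t = c' t) ->
  gap_count n c Q = gap_count n c' Q.
Proof.
elim: n c c' Q => //= n IH c c' Q cc'; rewrite cc' //.
by apply: eq_bigr => l _; apply: IH => t tn; rewrite cc'.
Qed.

Lemma gap_count0 n c i : i < n -> 0 < c i -> gap_count n c 0 = 0.
Proof.
elim: n c i => //= n IH c [|i] ni ci; rewrite big1 // => l; rewrite (ord1 l) /=; first by lia.
by move=> _; apply: IH ci.
Qed.

(** Reindexing by l = e + k m; off this progression the terms vanish. *)
Lemma sum_gap_class (V : zmodType) (f : nat -> V) c e k Q : 0 < k ->
  (\sum_(l < Q.+1 | (c + l <= Q)%N)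
    (if ((e <= l) && (k %| l - e))%N then f ((l - e) %/ k)%N else 0) =
  \sum_(l < Q.+1 | (c + e + k * l <= Q)%N) f l)%R.
Proof.
move=> k0.
transitivity (\sum_(l < Q.+1 | (c + l <= Q)%N)
    \sum_(m < Q.+1 | (e + k * m == l)%N) f m)%R.
  apply: eq_bigr => l cl; case: ifP => [/andP[el /dvdnP[m mE]]|].
    have mk : l = e + k * m :> nat by lia.
    have mQ : m < Q.+1 by have := ltn_ord l; nia.
    rewrite mE mulnK // (big_pred1 (Ordinal mQ)) // => i.
    rewrite mk eqn_add2l eqn_pmul2l //.
  move/negbT => nd; rewrite big_pred0 // => m; apply: contraNF nd => /eqP <-.
  by rewrite leq_addr addKn dvdn_mulr.
rewrite (exchange_big_dep xpredT) //= [RHS]big_mkcond /=.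
apply: eq_bigr => m _.
case: ifP => h.
  have lQ : e + k * m < Q.+1 by lia.
  rewrite (big_pred1 (Ordinal lQ)) // => l; rewrite /= -[RHS]val_eqE /=.
  by apply/andP/eqP => [[_ /eqP]|->] //; split=> //; rewrite addnA.
by rewrite big_pred0 // => l; apply: contraFF h => /andP[h /eqP e']; lia.
Qed.

Lemma sum_residue_gap (V : zmodType) (f : nat -> V) a e d k Q : 0 < k ->
  (\sum_(t < k) (if ((a + e + t <= Q) && (k %| Q - (a + e + t)))%N then
     \sum_(l < ((Q - (a + e + t)) %/ k).+1 | (d + l <= (Q - (a + e + t)) %/ k)%N) f l
     else 0) =
  \sum_(l < Q.+1 | (a + k * d + e + k * l <= Q)%N) f l)%R.
Proof.
move=> k0; have [aQ|aQ] := leqP (a + e) Q; last first.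
  rewrite big1 ?big_pred0 // => [l|t _]; first by apply/negbTE; lia.
  by case: ifP => // /andP[]; lia.
have tk : (Q - (a + e)) %% k < k by rewrite ltn_mod.
have E := divn_eq (Q - (a + e)) k.
set M := (Q - (a + e)) %/ k in E; set t0 := _ %% k in tk E.
rewrite (bigD1 (Ordinal tk)) //= [X in (_ + X)%R]big1 ?addr0; last first.
  move=> t; rewrite -val_eqE /= => tn; case: ifP => // /andP[h /dvdnP[m mE]].
  exfalso; move/eqP: tn; apply.
  have -> : (t : nat) = (t + m * k) %% k by rewrite addnC modnMDl modn_small.
  have -> : t + m * k = t0 + M * k by lia.
  by rewrite addnC modnMDl modn_small.
have -> : Q - (a + e + t0) = M * k by lia.
rewrite dvdn_mull // mulnK // (_ : a + e + t0 <= Q) /=; last by lia.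
have MQ : M.+1 <= Q.+1 by nia.
rewrite (big_ord_widen_cond _ (fun l => d + l <= M) f MQ).
by apply: eq_bigl => l; apply/idP/idP; nia.
Qed.

(* Writing each gap as g = a + r + k h with 0 <= r < k, the condition
   g >= a + k d becomes h >= d. *)
Lemma gap_count_div n a k d Q : 0 < k ->
  ((gap_count n (fun t => (a + k * d t)%N) Q)%:R = residue_sum k n (fun j =>
    if ((a * n + j <= Q) && (k %| Q - (a * n + j)))%N
    then (gap_count n d ((Q - (a * n + j)) %/ k)%N)%:R : int else 0))%R.
Proof.
move=> k0; elim: n d Q => [|n IH] d Q /=.
  rewrite muln0 addn0 subn0; case: Q => [|Q] /=; first by rewrite dvdn0 div0n.
  by case: ifP => // kQ; rewrite (_ : _ %/ _ == 0 = false) // eqn0Ngt divn_gt0 // dvdn_leq.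
rewrite natr_sum; under eq_bigr do rewrite IH.
rewrite -!residue_sum_sum; apply: eq_residue_sum => j _ /=.
(* With [j] the sum of the residues of the later gaps, both sides become a sum over the l with a + k
   d_0 + (a n + j) + k l <= Q. *)
rewrite (sum_gap_class _ (fun i => (gap_count n (fun t => d t.+1%N) i)%:R%R)) //.
rewrite -(sum_residue_gap _ (fun i => (gap_count n (fun t => d t.+1%N) i)%:R%R)) //.
apply: eq_bigr => t _; rewrite natr_sum.
by rewrite (_ : a * n.+1 + (t + j) = a + (a * n + j) + t) //; lia.
Qed.

Fixpoint spaced (c : nat -> nat) q z zs :=
  if zs is z' :: zs' then (z + c 0 <= z') && spaced (fun t => c t.+1) q z' zs'
  else z + c 0 <= q.

Lemma spacedP c q z zs :
  reflect ((forall t, t < size zs -> nth 0 (z :: zs) t + c t <= nth 0 (z :: zs) t.+1)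
           /\ last z zs + c (size zs) <= q) (spaced c q z zs).
Proof.
elim: zs c z => [|z' zs IH] c z /=.
  by apply: (iffP idP) => [|[]].
apply: (iffP andP) => [[h /IH[h1 h2]]|[h1 h2]].
  by split=> // -[|t] // /h1.
by split; [exact: (h1 0)|apply/IH; split=> // t ts; exact: (h1 t.+1)].
Qed.

(** Points correspond to their n + 1 consecutive gaps; a positive last gap keeps all points below
    [q], as the type ['I_q] demands. *)
Lemma card_spaced n c q z : 0 < c n -> z <= q ->
  \sum_(zs : n.-tuple 'I_q) spaced c q z (map val zs) = gap_count n.+1 c (q - z).
Proof.
elim: n c z => [|n IH] c z cn zq.
  rewrite (big_pred1 [tuple]) => [|t] /=; last by rewrite tuple0.
  rewrite big_mkcond big_ord_recl big1 /= => [|i _]; last by case: ifP.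
  by rewrite !addn0 -leq_subRL // addnC; case: leqP.
rewrite (reindex (fun p : 'I_q * n.-tuple 'I_q => [tuple of p.1 :: p.2])) /=; last first.
  exists (fun t : n.+1.-tuple 'I_q => (thead t, [tuple of behead t])).
    by move=> [u v] _; congr pair; apply: val_inj.
  by move=> t _ /=; rewrite -tuple_eta.
rewrite -(pair_bigA _ (fun u (v : n.-tuple 'I_q) =>
   ((z + c 0 <= val u) && spaced (fun t => c t.+1) q (val u) (map val v) : nat))) /=.
transitivity (\sum_(u < q | z + c 0 <= u) gap_count n.+1 (fun t => c t.+1) (q - u)).
  rewrite [RHS]big_mkcond; apply: eq_bigr => u _; case: leqP => h; last by rewrite big1.
  by apply: IH => //; exact: ltnW (ltn_ord u).
set G := gap_count n.+1 (fun t => c t.+1).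
(* A point u < q leaves a remainder q - u > 0, while [gap_count] also allows remainder 0; that term
   vanishes. *)
have G0 : G 0 = 0 by apply: (gap_count0 _ _ n).
transitivity (\sum_(l < (q - z).+1 | c 0 + l <= q - z) G l); last by [].
rewrite (reindex_inj rev_ord_inj) /=; move: G G0 => G G0.
have qz : (q - z).+1 <= q.+1 by lia.
rewrite [RHS](big_ord_widen_cond _ (fun l => c 0 + l <= q - z) G qz).
rewrite [RHS]big_mkcond big_ord_recl /= G0 if_same add0n.
rewrite -[RHS]big_mkcond /=; apply: eq_big => l; have := ltn_ord l.
  by rewrite /bump /=; lia.
by move=> lq _; congr G; rewrite /bump /=; lia.
Qed.

End GapCount.

(** * Cyclic words and their gaps *)

Section CyclicGaps.
Local Open Scope nat_scope.

(* For i < j the difference x_i - x_j avoids -a+1,...,b-1 modulo q; here x_i is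
   the representative in [0,q). *)
Definition well_spaced n q a b (x : 'I_n -> 'I_q) :=
  [forall i : 'I_n, forall j : 'I_n, (i < j) ==>
    if x i <= x j then (x i + a <= x j) && (x j + b <= q + x i)
    else (x j + b <= x i) && (x i + a <= q + x j)].

(** The pair (x_i, i) in lexicographic order: equal values are listed by increasing index, hence
    without a descent. *)
Definition sort_key n q (x : 'I_n -> 'I_q) (i : 'I_n) := x i * n + i.

Lemma sort_key_lt n q (x : 'I_n -> 'I_q) i j :
  (sort_key n q x i < sort_key n q x j) =
  (x i < x j) || (x i == x j :> nat) && (i < j).
Proof.
rewrite /sort_key; have := ltn_ord i; have := ltn_ord j.
by case: ltngtP => [h|h|->] /=; rewrite ?ltn_add2l //; nia.
Qed.

Definition sorts n q (x : 'I_n -> 'I_q) (s : {perm 'I_n}) :=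
  sorted ltn [seq sort_key n q x (s i) | i <- enum 'I_n].

(** The keys are pairwise distinct. This splits a count of x over permutations. *)
Lemma sorts_unique n q (x : 'I_n -> 'I_q) : \sum_(s : {perm 'I_n}) sorts n q x s = 1.
Proof.
have keyI : injective (sort_key n q x).
  move=> i j e; apply/val_inj => /=.
  move: (sort_key_lt n q x i j) (sort_key_lt n q x j i).
  by rewrite e ltnn; case: (ltngtP (x i)) => //= _; case: ltngtP.
pose leT := relpre (sort_key n q x) leq.
have /tuple_permP[s sE] : perm_eq (sort leT (enum 'I_n)) (ord_tuple n).
  by rewrite perm_sort.
have {}sE : sort leT (enum 'I_n) = map s (enum 'I_n).
  by rewrite sE /=; apply: eq_map => i; rewrite tnth_ord_tuple.
have ss : sorts n q x s.
  rewrite /sorts map_comp -sE ltn_sorted_uniq_leq map_inj_uniq // sort_uniq enum_uniq /=.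
  rewrite sorted_map; apply: sort_sorted => i j; exact: leq_total.
rewrite (bigD1 s) //= ss big1 // => s' s'n; case: (boolP (sorts n q x s')) => // s's.
case/eqP: s'n; apply/permP => i.
have e : [seq s' i | i <- enum 'I_n] = [seq s i | i <- enum 'I_n].
  apply: (inj_map keyI); apply: (irr_sorted_eq ltn_trans ltnn).
  - by rewrite -map_comp.
  - by rewrite -map_comp.
  move=> u; rewrite -!map_comp.
  apply/mapP/mapP => -[j _ ->] /=.
    by exists ((s^-1)%g (s' j)); rewrite ?permKV // -enumT mem_enum.
  by exists ((s'^-1)%g (s j)); rewrite ?permKV // -enumT mem_enum.
by move/eq_in_map: e => /(_ i); rewrite mem_enum => ->.
Qed.

Context (n q a k : nat).
Context (k_gt0 : 0 < k) (q_ge : a + k <= q).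
Implicit Types (x : {ffun 'I_n.+1 -> 'I_q}) (s : {perm 'I_n.+1}).

(* The last entry stands for the descent from the end of the word s back to
   s_0 = 0; it is counted as a descent also when n = 0. *)
Definition cyclic_descent s (t : nat) : nat :=
  (t < n) ==> (s (inord t.+1) < s (inord t)).

Let gap s t := a + k * cyclic_descent s t.

Definition word_values x s := [seq val (x (s (lift ord0 i))) | i <- enum 'I_n].

Lemma nth_word x s t : x (s ord0) = 0 :> nat -> t <= n ->
  nth 0 (0 :: word_values x s) t = x (s (inord t)).
Proof.
move=> x0; case: t => [|t] tn /=.
  by have -> : inord 0 = ord0 :> 'I_n.+1; [apply/val_inj; rewrite /= inordK | rewrite x0].
rewrite (nth_map (Ordinal tn)) ?size_enum_ord //.
have -> // : nth (Ordinal tn) (enum 'I_n) t = Ordinal tn.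
  by apply/val_inj; rewrite /= nth_enum_ord.
by congr (val (x (s _))); apply/val_inj; rewrite /= inordK.
Qed.

Lemma spaced_wordP x s : x (s ord0) = 0 :> nat ->
  reflect ((forall t, t < n -> x (s (inord t)) + gap s t <= x (s (inord t.+1)))
           /\ x (s (inord n)) + (a + k) <= q) (spaced (gap s) q 0 (word_values x s)).
Proof.
move=> x0; have sz : size (word_values x s) = n by rewrite size_map size_enum_ord.
have lst : last 0 (word_values x s) = x (s (inord n)).
  by rewrite (last_nth 0) sz nth_word.
have gn : gap s n = a + k by rewrite /gap /cyclic_descent ltnn muln1.
apply: (iffP (spacedP _ _ _ _)); rewrite sz lst gn => -[h1 h2]; split=> // t tn.
  by have := h1 t tn; rewrite !nth_word // ltnW.
by rewrite !nth_word // ?h1 // ltnW.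
Qed.

Lemma sorts_lt x s t t' : sorts n.+1 q x s -> t < t' <= n ->
  sort_key n.+1 q x (s (inord t)) < sort_key n.+1 q x (s (inord t')).
Proof.
move=> ss /andP[tt' t'n].
have tn : t < n.+1 := leq_trans tt' (leqW t'n).
have := sorted_ltn_nth ltn_trans 0 ss t t'.
rewrite !inE size_map size_enum_ord => /(_ tn t'n tt').
have nthE u : u < n.+1 -> nth ord0 (enum 'I_n.+1) u = inord u.
  by move=> un; apply/val_inj; rewrite /= nth_enum_ord // inordK.
by rewrite !(nth_map ord0) -?enumT ?size_enum_ord ?nthE.
Qed.

(** The key of index 0 is 0, the least possible. *)
Lemma sorts_ord0 x s : x ord0 = 0 :> nat -> sorts n.+1 q x s -> s ord0 = ord0.
Proof.
move=> x0 ss; have [t0|tn0] := eqVneq ((s^-1)%g ord0) ord0.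
  by rewrite -[in LHS]t0 permKV.
have := sorts_lt x s 0 ((s^-1)%g ord0) ss.
rewrite inord_val permKV lt0n -ltnS ltn_ord andbT => /(_ tn0).
by rewrite {2}/sort_key x0.
Qed.

Lemma spaced_of_well_spaced x s : x ord0 = 0 :> nat ->
  well_spaced n.+1 q a (a + k) x -> sorts n.+1 q x s ->
  spaced (gap s) q 0 (word_values x s).
Proof.
move=> x0 W ss; have s0 := sorts_ord0 x s x0 ss.
have {}W (i j : 'I_n.+1) (ij : i < j) := implyP (forallP (forallP W i) j) ij.
apply/spaced_wordP; first by rewrite s0.
split=> [t tn|].
  have := sorts_lt x s t t.+1 ss; rewrite ltnSn tn => /(_ isT).
  rewrite sort_key_lt /gap /cyclic_descent tn /=.
  have [lt|gt|e] := ltngtP (s (inord t)) (s (inord t.+1)).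
  - by have := W _ _ lt; case: ltngtP => //= h /andP[]; lia.
  - by have := W _ _ gt; case: ltngtP => //= h /andP[]; lia.
  - by rewrite andbF orbF; move/val_inj: e => ->; rewrite ltnn.
(* The closing gap is the condition on the pair (0, s_n), where x_0 = 0; for a single letter it is a
   + k <= q. *)
have [n0|n0] := posnP n.
  rewrite (_ : s (inord n) = ord0) ?x0 //; rewrite -s0; congr (s _).
  by apply/val_inj; rewrite /= inordK.
have sn : (ord0 : 'I_n.+1) < s (inord n).
  rewrite lt0n -[X in _ != X]/(val (ord0 : 'I_n.+1)) val_eqE -s0.
  by rewrite (inj_eq perm_inj) -val_eqE /= inordK // -lt0n.
by have := W _ _ sn; rewrite x0 /=; lia.
Qed.

(** Gaps add up, and a stretch of the word that ends lower than it starts contains a descent, so its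
    length is at least a + k. *)
Lemma spaced_chain x s t t' : x (s ord0) = 0 :> nat ->
  spaced (gap s) q 0 (word_values x s) -> t <= t' <= n ->
  x (s (inord t)) + (if s (inord t') < s (inord t) then a + k else (t < t') * a)
  <= x (s (inord t')).
Proof.
move=> x0 /(spaced_wordP _ _ x0)[h _]; elim: t' => [|t' IH].
  by rewrite leqn0 andbT => /eqP ->; rewrite ltnn addn0.
rewrite leq_eqVlt => /andP[/orP[/eqP ->|tt'] t'n]; first by rewrite !ltnn addn0.
have := h t' t'n; have := IH; rewrite -ltnS tt' (ltnW t'n) => /(_ isT).
rewrite /gap /cyclic_descent t'n /=.
case: ifP; case: ifP; case: (ltnP t t') => /=;
  case: (ltnP (s (inord t'.+1)) (s (inord t'))); lia.
Qed.

Lemma well_spaced_of_spaced x s : x (s ord0) = 0 :> nat ->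
  spaced (gap s) q 0 (word_values x s) ->
  well_spaced n.+1 q a (a + k) x && sorts n.+1 q x s.
Proof.
move=> x0 sp; have chain := spaced_chain x s _ _ x0 sp.
have [h lst] := spaced_wordP _ _ x0 sp.
have posE (i : 'I_n.+1) : s (inord ((s^-1)%g i)) = i by rewrite inord_val permKV.
(* The closing gap gives every letter this room below q, whence the wrap-around inequalities. *)
have top (i : 'I_n.+1) : x i + (a + k) <= q.
  have := chain ((s^-1)%g i) n; rewrite posE -ltnS ltn_ord leqnn => /(_ isT).
  by case: ifP; lia.
apply/andP; split.
  apply/forallP => i; apply/forallP => j; apply/implyP => ij.
  have := chain ((s^-1)%g i) ((s^-1)%g j); have := chain ((s^-1)%g j) ((s^-1)%g i).
  have tle (u : 'I_n.+1) : (s^-1)%g u <= n by rewrite -ltnS.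
  have ji : (j < i) = false by lia.
  rewrite !posE ij ji !tle !andbT.
  have := top i; have := top j.
  have [lt|gt|/val_inj/perm_inj e] := ltngtP ((s^-1)%g i) ((s^-1)%g j).
  - move=> ? ? _ /(_ isT); rewrite mul1n => ?; case: (leqP (x i) (x j)); lia.
  - move=> ? ? /(_ isT) ? _; case: (leqP (x i) (x j)); lia.
  - by rewrite e ltnn in ij.
apply/(sortedP 0) => t; rewrite size_map size_enum_ord ltnS => tn.
have nthE u : u < n.+1 -> nth ord0 (enum 'I_n.+1) u = inord u.
  by move=> un; apply/val_inj; rewrite /= nth_enum_ord // inordK.
rewrite !(nth_map ord0) -?enumT ?size_enum_ord ?nthE //; try exact: ltnW.
have := h t tn; rewrite /= sort_key_lt /gap /cyclic_descent tn /=.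
have [lt|gt|/val_inj/perm_inj e] := ltngtP (s (inord t)) (s (inord t.+1)).
- by case: ltngtP => //=; lia.
- by case: ltngtP => //=; lia.
- by have := congr1 val e; rewrite /= !inordK //; lia.
Qed.

Definition based_count b := \sum_(x : {ffun 'I_n.+1 -> 'I_q} | x ord0 == 0 :> nat)
  well_spaced n.+1 q a b x.

Lemma based_count_gaps : based_count (a + k) =
  \sum_(s : {perm 'I_n.+1} | s ord0 == ord0)
    gap_count n.+1 (fun t => a + k * cyclic_descent s t) q.
Proof.
have q0 : 0 < q by lia.
transitivity (\sum_(x : {ffun 'I_n.+1 -> 'I_q} | x ord0 == 0 :> nat)
    \sum_(s : {perm 'I_n.+1} | s ord0 == ord0) spaced (gap s) q 0 (word_values x s)).
  apply: eq_bigr => x /eqP x0.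
  (* The factor 1 counts the permutations sorting x; such a permutation fixes 0 because x_0 = 0. *)
  rewrite -[LHS]muln1 -(sorts_unique _ _ x) big_distrr /= [RHS]big_mkcond /=.
  apply: eq_bigr => s _; rewrite mulnb; case: eqP => s0.
    congr nat_of_bool; apply/idP/idP => [/andP[]|]; first exact: spaced_of_well_spaced.
    by apply: well_spaced_of_spaced; rewrite s0.
  by case: (boolP (sorts _ _ _ _)) => [/(sorts_ord0 _ _ x0)|]; rewrite ?andbF.
rewrite exchange_big /=; apply: eq_bigr => s /eqP s0.
have gn : 0 < gap s n by rewrite /gap /cyclic_descent ltnn muln1; lia.
rewrite -[in RHS](subn0 q) -[RHS](card_spaced n (gap s) q 0 gn (leq0n _)).
pose o := Ordinal q0.
(* [zs] lists the values at the letters after s_0, and the head [o] is the value 0 at s_0. *)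
rewrite (reindex_onto
  (fun zs : n.-tuple 'I_q => [ffun i => nth o (o :: zs) ((s^-1)%g i)])
  (fun x => [tuple x (s (lift ord0 t)) | t < n])) /=; last first.
  move=> x /eqP x0; apply/ffunP => i; rewrite ffunE.
  have <- : s ((s^-1)%g i) = i by rewrite permKV.
  rewrite permK; case: (unliftP ord0 ((s^-1)%g i)) => [j|] -> /=.
    by rewrite add0n (nth_map j) -?enumT ?size_enum_ord // nth_ord_enum.
  by apply/val_inj; rewrite /= s0 x0.
have wE (zs : n.-tuple 'I_q) (t : 'I_n) :
    [ffun i => nth o (o :: zs) ((s^-1)%g i)] (s (lift ord0 t)) = tnth zs t.
  by rewrite ffunE permK /= (tnth_nth o).
apply: eq_big => zs.
  rewrite ffunE -{1}s0 permK eqxx /=; apply/eqP/eq_from_tnth => t.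
  by rewrite tnth_mktuple wE.
move=> _; congr (nat_of_bool (spaced _ _ _ _)); rewrite /word_values.
rewrite (eq_map (fun t => congr1 val (wE zs t))) map_comp; congr (map _ _).
by rewrite -[RHS]map_tnth_enum.
Qed.
End CyclicGaps.

(** * Closed form of the count *)

Section ClosedForm.
Local Open Scope nat_scope.

(** The forbidden range -a+1, ..., b-1 is empty here. *)
Lemma well_spaced01 n m (x : 'I_n -> 'I_m) : well_spaced n m 0 1 x.
Proof.
apply/forallP => i; apply/forallP => j; apply/implyP => _.
have := ltn_ord (x i); have := ltn_ord (x j).
by case: (leqP (x i) (x j)); lia.
Qed.

Lemma based_count_unspaced n m : 0 < m -> based_count n m 0 1 = m ^ n.
Proof.
move=> m0; pose o := Ordinal m0.
transitivity (\sum_(x : {ffun 'I_n.+1 -> 'I_m})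
    \prod_i (if i == ord0 then (x i == o : nat) else 1)).
  rewrite /based_count big_mkcond; apply: eq_bigr => x _.
  rewrite big_ord_recl /= big1 ?muln1 => [|i _]; last by [].
  rewrite -val_eqE /=; case: eqP => // _; rewrite (_ : well_spaced _ _ _ _ _) //.
  exact: well_spaced01.
rewrite -(bigA_distr_bigA (fun i j => if i == ord0 then (j == o : nat) else 1)).
rewrite big_ord_recl /= (bigD1 o) //= big1 => [|j /negPf ->] //.
rewrite addn0 mul1n; under eq_bigr do rewrite sum1_card card_ord.
by rewrite prod_nat_const card_ord.
Qed.

(** The bound on q keeps q - a(n+1) - j >= k for all j <= (n+1)k, so that no subtraction truncates
    and the quotient m by k is positive. *)
Lemma based_count_formula n a k q : 0 < k -> a * n.+1 + n.+2 * k <= q ->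
  ((k ^ n.+1)%:R * (based_count n q a (a + k)%N)%:R =
  residue_sum k n.+1 (fun j => ((q%:R - (a * n.+1)%:R) - j%:R) ^+ n) :> int)%R.
Proof.
move=> k0 qge.
(* One factor k trades the divisibility condition away by equidistribution; the remaining k^n turns
   m^n into (q - a(n+1) - j)^n. *)
rewrite -(residue_sum_class _ _ _ _ _ (q - a * n.+1)) // expnS natrM -mulrA.
congr (_ * _)%R; rewrite based_count_gaps //; last by nia.
rewrite natr_sum; under eq_bigr do rewrite gap_count_div //.
rewrite -residue_sum_sum -residue_sum_mull; apply: eq_residue_sum => j jn.
have jq : a * n.+1 + j <= q by nia.
have aq : a * n.+1 <= q := leq_trans (leq_addr _ _) jq.
have jq' : j <= q - a * n.+1 by rewrite leq_subRL.
rewrite jq /= -eqn_mod_dvd //.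
rewrite -[X in X == _ %[mod _]](subnKC aq).
rewrite eqn_modDl eq_sym; case: ifP => [|_]; last by rewrite big1 // mulr0.
rewrite eq_sym eqn_mod_dvd // -subnDA => /dvdnP[m mE]; rewrite mE mulnK //.
have m0 : 0 < m by nia.
(* The unconstrained case (a,b) = (0,1), read backwards, sums the gap counts over all words. *)
have S : m ^ n = \sum_(s : {perm 'I_n.+1} | s ord0 == ord0)
    gap_count n.+1 (cyclic_descent n s) m.
  rewrite -based_count_unspaced // -[1]/(0 + 1) based_count_gaps //.
  by apply: eq_bigr => s _; apply: eq_gap_count => t _; rewrite mul1n.
rewrite -natr_sum -[X in (_ * X%:R)%R]S.
rewrite -natrM -expnMn mulnC -mE -natrB //.
by rewrite -natrB ?natrX ?subnDA.
Qed.

End ClosedForm.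

(** * Point counts modulo q *)

(** As x is the least element, the recursion [mobiusE] runs over everything strictly below z. *)
Lemma sum_mobius_le d (T : porderType d) (P : {fset T}) (x z : T) :
  x \in P -> z \in P -> (forall y, y \in P -> (x <= y)%O) ->
  \sum_(y <- P | (y <= z)%O) mobius P x y = (z == x)%:R.
Proof.
move=> xP zP xmin; have [->|zx] := eqVneq z x.
  rewrite big_mkcond (bigD1_seq x) ?fset_uniq //= lexx mobius_refl //.
  rewrite big_seq_cond big1 ?addr0 //.
  move=> y /andP[yP yx]; case: ifP => // /(conj (xmin y yP))/andP/le_anti e.
  by rewrite e eqxx in yx.
rewrite big_mkcond (bigD1_seq z) ?fset_uniq //= lexx mobiusE // 1?eq_sym //.
rewrite addrC -big_mkcondr /= [X in X - _]big_seq_cond [X in _ - X]big_seq_cond.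
apply/eqP; rewrite subr_eq0; apply/eqP; apply: eq_bigl => y.
by case yP: (y \in P) => //=; rewrite xmin // lt_neqAle.
Qed.

Section Components.
Context (T : finType) (e : rel T).
Context (e_sym : connect_sym e).

Lemma connect_constP (S : Type) (f : T -> S) :
  (forall i j, e i j -> f i = f j) <-> (forall i, f i = f (fingraph.root e i)).
Proof.
split=> [h i|h i j eij]; last first.
  by rewrite h [RHS]h; congr f; apply/fingraph.rootP => //; exact: connect1.
have /connectP[p ep ->] := connect_root e i.
elim: p i ep => //= j p IH i /andP[eij ep]; rewrite (h _ _ eij); exact: IH.
Qed.

End Components.

Section Lift.
Context (n q M : nat).
Context (q_gt : (n * M < q)%N).

(** Pigeonhole: a bad rotation t is determined by an index i and the place of x_i + t among the last
    M residues, so fewer than q rotations are bad. *)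
Lemma cyclic_gap (x : 'I_n -> 'I_q) :
  exists t : nat, forall i, ((x i + t) %% q < q - M)%N.
Proof.
have [[t h]|noT] := pselect (exists t : 'I_q, forall i, ((x i + t) %% q < q - M)%N).
  by exists t.
have bad (t : 'I_q) : exists i, (q - M <= (x i + t) %% q)%N.
  apply: contrapT => nex; apply: noT; exists t => i.
  by rewrite ltnNge; apply/negP => h; apply: nex; exists i.
have [i iP] := choice bad.
have rM (t : 'I_q) : ((x (i t) + t) %% q - (q - M) < M)%N.
  by have := ltn_pmod (x (i t) + t) (leq_ltn_trans (leq0n _) q_gt); have := iP t; lia.
suff inj : injective (fun t => (i t, Ordinal (rM t))).
  have := leq_card _ inj; rewrite card_prod !card_ord; lia.
move=> t t' [e1 e2]; have {}e2 : ((x (i t) + t) %% q = (x (i t) + t') %% q)%N.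
  by have := iP t; have := iP t'; rewrite -e1 in e2 *; lia.
apply/val_inj; rewrite /= -(modn_small (ltn_ord t)) -(modn_small (ltn_ord t')).
by apply/eqP; rewrite -(eqn_modDl (x (i t))) e2.
Qed.

(* Cutting the circle Z/q in a gap longer than M turns all congruences
   x_i - x_j = k (mod q) with |k| <= M into equalities of integers. *)
Lemma lift_mod (x : 'I_n -> 'I_q) : exists y : 'I_n -> int,
  forall i j (k : int), `|k| <= M%:Z ->
    (q%:Z %| (x i)%:Z - (x j)%:Z - k)%Z <-> y i - y j = k.
Proof.
have [t h] := cyclic_gap x; exists (fun i => ((x i + t) %% q)%N%:Z) => i j k kM.
have q0 : (0 < q)%N by lia.
have E (u : 'I_n) : (x u)%:Z = ((x u + t) %/ q)%N%:Z * q%:Z + ((x u + t) %% q)%N%:Z - t%:Z.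
  by rewrite -PoszM -PoszD -divn_eq PoszD addrK.
have := h i; have := h j; rewrite {h}(E i) (E j).
move: ((x i + t) %/ q)%N ((x j + t) %/ q)%N ((x i + t) %% q)%N ((x j + t) %% q)%N.
move=> u v r s sq rq; split=> [/dvdzP[w wE]|<-].
  (* Both lifts lie in [0, q - M) and |k| <= M, so the difference of the lifts minus k is a multiple
     of q smaller than q in absolute value. *)
  have : w = u%:Z - v%:Z by nia.
  by nia.
by apply/dvdzP; exists (u%:Z - v%:Z); lia.
Qed.

End Lift.

(** Modulo q, x - m is constant on each component of [e] with a free value there; the values at the
    representatives parametrize the solutions. *)
Lemma card_mod_system n q (e : rel 'I_n) (m : 'I_n -> int) :
  (0 < q)%N -> connect_sym e ->
  #|[set x : {ffun 'I_n -> 'I_q} | [forall i, forall j, e i j ==>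
       (q%:Z %| (x i)%:Z - (x j)%:Z - (m i - m j))%Z]]| = (q ^ #|roots e|)%N.
Proof.
case: q => // q _ es.
pose modq (z : int) : 'I_q.+1 := inord `|(z %% q.+1%:Z)%Z|%N.
have modqE z : (modq z)%:Z = (z %% q.+1%:Z)%Z.
  have z0 : (0 <= z %% q.+1%:Z)%Z by rewrite modz_ge0.
  rewrite /modq inordK ?gez0_abs //.
  by rewrite -ltz_nat gez0_abs // ltz_pmod.
have modq_cong z : (q.+1%:Z %| (modq z)%:Z - z)%Z.
  by rewrite modqE -eqz_mod_dvd modz_mod.
have modq_eq z (u : 'I_q.+1) : (q.+1%:Z %| z - u%:Z)%Z -> modq z = u.
  rewrite -eqz_mod_dvd => /eqP h; apply/val_inj/eqP; rewrite -eqz_nat modqE h.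
  by rewrite modz_small //= ltz_nat ltn_ord.
pose rt i : {i : 'I_n | roots e i} := exist _ (fingraph.root e i) (roots_root es i).
pose Phi (g : {ffun {i : 'I_n | roots e i} -> 'I_q.+1}) : {ffun 'I_n -> 'I_q.+1} :=
  [ffun i => modq ((g (rt i))%:Z + m i)].
have rtK (r : {i : 'I_n | roots e i}) : rt (val r) = r.
  by apply/val_inj; rewrite /=; apply/eqP; exact: (valP r).
have PhiI : injective Phi.
  move=> g g' /ffunP eg; apply/ffunP => r; apply/val_inj/eqP.
  have := eg (val r); rewrite !ffunE !rtK => /(congr1 (fun u : 'I_q.+1 => (u : nat)%:Z)).
  rewrite !modqE => /eqP; rewrite eqz_modDr => /eqP.
  by rewrite !modz_small ?ltz_nat ?ltn_ord //= => -[->].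
have <- : #|[set: {ffun {i : 'I_n | roots e i} -> 'I_q.+1}]| = (q.+1 ^ #|roots e|)%N.
  by rewrite cardsT card_ffun card_ord card_sig.
rewrite -(card_imset _ PhiI); congr #|pred_of_set _|; apply/setP => x.
rewrite inE; apply/idP/imsetP => [/forallP h|[g _ ->]]; last first.
  apply/forallP => i; apply/forallP => j; apply/implyP => eij.
  have rij : rt i = rt j.
    by apply/val_inj => /=; apply/fingraph.rootP => //; exact: connect1.
  rewrite !ffunE rij.
  have := rpredB (modq_cong ((g (rt j))%:Z + m i)) (modq_cong ((g (rt j))%:Z + m j)).
  by congr (_ %| _)%Z; ring.
have {}h i : (q.+1%:Z %|
    (x i)%:Z - m i - ((x (fingraph.root e i))%:Z - m (fingraph.root e i)))%Z.
  rewrite -eqz_mod_dvd; apply/eqP.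
  apply: ((connect_constP _ _ es _ (fun i => ((x i)%:Z - m i) %% q.+1%:Z)%Z).1 _ i).
  move=> {}i j eij; apply/eqP; rewrite eqz_mod_dvd.
  by have /implyP/(_ eij) := forallP (h i) j; congr (_ %| _)%Z; ring.
exists [ffun r => modq ((x (val r))%:Z - m (val r))]; first by rewrite inE.
apply/ffunP => i; rewrite !ffunE; apply/esym/modq_eq => /=.
have := rpredB (modq_cong ((x (fingraph.root e i))%:Z - m (fingraph.root e i))) (h i).
by congr (_ %| _)%Z; ring.
Qed.

(** Vectors constant on components have one free coordinate per component; the sum-zero condition
    costs exactly one dimension, as the all-ones vector violates it. *)
Lemma dim_sum0_components (R : realType) n (e : rel 'I_n.+1) : connect_sym e ->
  exists U : {vspace 'rV[R]_n.+1},
    (forall v, v \in U <-> v \in sum0_space R n.+1 /\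
       forall i, v 0 i = v 0 (fingraph.root e i)) /\
    (\dim U).+1 = #|roots e|.
Proof.
move=> es; set c := #|roots e|.
have rin i : fingraph.root e i \in roots e := roots_root es i.
pose idx i : 'I_c := enum_rank_in (rin ord0) (fingraph.root e i).
have idxK i : enum_val (idx i) = fingraph.root e i.
  by rewrite enum_rankK_in.
pose B : 'M[R]_(c, n.+1) := \matrix_(r, i) (r == idx i)%:R.
have BE (u : 'rV[R]_c) i : (u *m B) 0 i = u 0 (idx i).
  rewrite mxE (bigD1 (idx i)) //= mxE eqxx mulr1 big1 ?addr0 // => r /negPf rn.
  by rewrite mxE rn mulr0.
pose f := linfun (mulmxr B : 'rV[R]_c -> 'rV[R]_n.+1).
have fE u : f u = u *m B by rewrite lfunE.
have fI : lker f == 0%VS.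
  apply/lker0P => u u' /rowP fu; apply/rowP => r; have := fu (enum_val r).
  rewrite !fE !BE; suff -> : idx (enum_val r) = r by [].
  apply: enum_val_inj; rewrite idxK; apply/eqP; exact: (enum_valP r).
have memf v : v \in limg f <-> forall i, v 0 i = v 0 (fingraph.root e i).
  split=> [/memv_imgP[u _ ->] i|h].
    by rewrite fE !BE; congr (u 0 _); rewrite /idx root_root.
  apply/memv_imgP; exists (\row_r v 0 (enum_val r)); rewrite ?memvf //.
  by apply/rowP => i; rewrite fE BE mxE idxK.
have dimf : \dim (limg f) = c.
  by rewrite limg_dim_eq ?(eqP fI) ?capv0 // dimvf /dim /= mul1n.
exists (limg f :&: sum0_space R n.+1)%VS; split.
  move=> v; rewrite memv_cap; split=> [/andP[/memf ? ?]|[? /memf ->]] //.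
apply: etrans dimf; rewrite -(limg_ker_dim (linfun (@coord_sum R n.+1)) (limg f)) -addn1.
congr addn; apply/eqP; rewrite eqn_leq; apply/andP; split; last first.
  by apply: leq_trans (dimvS (subvf _)) _; rewrite dimvf.
rewrite lt0n dimv_eq0; apply/eqP => g0.
have lin : linear (@coord_sum R n.+1).
  move=> k u v; rewrite /coord_sum scaler_sumr -big_split /=.
  by apply: eq_bigr => i _; rewrite !mxE.
pose g : {linear 'rV[R]_n.+1 -> R^o} := HB.pack (@coord_sum R n.+1)
  (GRing.isLinear.Build _ _ _ _ (@coord_sum R n.+1) lin).
have : linfun g (const_mx 1) \in (linfun g @: limg f)%VS.
  by rewrite memv_img //; apply/memf => i; rewrite !mxE.
rewrite g0 memv0 lfunE /= /coord_sum; under eq_bigr do rewrite mxE.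
by rewrite sumr_const card_ord pnatr_eq0.
Qed.

(** * Moebius inversion over the flats *)

Section PointCount.
Local Open Scope classical_set_scope.
Context (R : realType) (n a b q : nat).
Context (q_gt : (n.+1 * (a + b) < q)%N).

Local Notation V := (sum0_space R n.+1).
Local Notation A := (@truncated_arrangement R n.+1 a%:Z b%:Z).
Local Notation P := (intersection_poset V A).
Implicit Types (i j : 'I_n.+1) (k : int) (x : {ffun 'I_n.+1 -> 'I_q}).
Implicit Types (F G : set 'rV[R]_n.+1).

Definition in_range i j k := [/\ (i < j)%N, - a%:Z + 1 <= k & k <= b%:Z - 1].

Definition congr_at x i j k := (q%:Z %| (x i)%:Z - (x j)%:Z - k)%Z.

(** The points of the reduction of F modulo q, F being described by all the hyperplanes that contain
    it. *)
Definition flat_mod x F := forall i j k,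
  in_range i j k -> F `<=` diff_hyperplane i j k -> congr_at x i j k.

Definition hyperplanes_mod x : set (set 'rV[R]_n.+1) :=
  [set H | exists i j k, [/\ in_range i j k, congr_at x i j k & H = diff_hyperplane i j k]].

Definition smallest_flat_mod x := [set` V] `&` \bigcap_(H in hyperplanes_mod x) H.

Definition generic_mod x := forall i j k, in_range i j k -> ~~ congr_at x i j k.

(** Subtracting the mean moves an integer point into V and keeps its differences. *)
Definition sum0_point (y : 'I_n.+1 -> int) : 'rV[R]_n.+1 :=
  \row_i ((y i)%:~R - (\sum_j (y j)%:~R) / n.+1%:R).

Lemma sum0_pointP y : sum0_point y \in V.
Proof.
rewrite mem_sum0_space; under eq_bigr do rewrite mxE.
rewrite sumrB sumr_const card_ord -[X in _ - X]mulr_natr divfK ?subrr //.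
by rewrite pnatr_eq0.
Qed.

Lemma sum0_point_diff y i j : sum0_point y 0 i - sum0_point y 0 j = (y i - y j)%:~R.
Proof. by rewrite !mxE intrB; ring. Qed.

(** The witness is the integer lift of x moved into V: it lies on exactly the hyperplanes whose
    equations hold for x modulo q. *)
Lemma smallest_flat_point x : exists z : 'rV[R]_n.+1, smallest_flat_mod x z /\
  forall i j k, in_range i j k -> diff_hyperplane i j k z -> congr_at x i j k.
Proof.
have [y yP] := lift_mod _ _ _ q_gt x.
have kM i j k : in_range i j k -> `|k| <= (a + b)%N%:Z by case=> _; lia.
exists (sum0_point y); split=> [|i j k r].
  split; first exact: sum0_pointP.
  move=> _ [i [j [k [r /yP yk ->]]]]; split; first exact: sum0_pointP.
  by rewrite sum0_point_diff yk // (kM i j).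
move=> [_]; rewrite sum0_point_diff => /eqP; rewrite eqr_int => /eqP yk.
by apply/yP => //; exact: (kM i j).
Qed.

Lemma smallest_flat_flat x : flats V A (smallest_flat_mod x).
Proof.
split; first by have [z [zF _]] := smallest_flat_point x; exists z.
by exists (hyperplanes_mod x) => // H [i [j [k [[]]]]]; exists i, j, k.
Qed.

(** The flats through x modulo q thus form a principal lower interval of the intersection poset. *)
Lemma flat_modE x F : flats V A F -> flat_mod x F <-> smallest_flat_mod x `<=` F.
Proof.
move=> [_ [B BA FE]]; split=> [h z [zV zH]|h i j k r FH].
  rewrite FE; split=> // H BH; have [i [j [k [? ? ? HE]]]] := BA _ BH.
  apply: zH; exists i, j, k; split=> //; apply: h => //.
  by rewrite FE -HE => u [_]; exact.
have [z [zF zP]] := smallest_flat_point x.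
by apply: zP => //; apply: FH; exact: h.
Qed.

Lemma smallest_flat_generic x :
  smallest_flat_mod x = [set` V] <-> generic_mod x.
Proof.
split=> [FV i j k r|g]; last first.
  apply/seteqP; split=> [z []//|z zV]; split=> // H [i [j [k [r c]]]].
  by rewrite (negPf (g _ _ _ r)) in c.
apply/negP => c; have sub z : z \in V -> z 0 i - z 0 j = k%:~R.
  move=> zV; have : smallest_flat_mod x z by rewrite FV.
  case=> _ /(_ (diff_hyperplane i j k)) h; apply: (h _).2.
  by exists i, j, k.
have [ij _ _] := r.
(* A hyperplane equal to V would contain 0, forcing k = 0, but the point built from the unit vector
   e_i has difference 1. *)
have k0 : k%:~R = 0 :> R by rewrite -(sub 0) ?mem0v // !mxE subrr.
have := sub (sum0_point (fun u => (u == i)%:Z)) (sum0_pointP _).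
have ji : (j == i) = false by apply/negP => /eqP e; rewrite e ltnn in ij.
rewrite sum0_point_diff k0 eqxx ji.
by move/eqP; rewrite intr_eq0.
Qed.

Lemma mem_ambient : ([set` V] : (set 'rV[R]_n.+1)^d) \in P.
Proof.
apply/mem_intersection_poset; first exact: finite_truncated_arrangement.
split; first by exists 0; rewrite /= mem0v.
by exists set0 => //; rewrite bigcap_set0 setIT.
Qed.

(** The equations of F form a graph on the indices; its number of components is dim F + 1 over the
    reals and the exponent of q modulo q. *)
Lemma card_flat_mod F : flats V A F ->
  (\sum_x `[< flat_mod x F >] = q ^ (aff_dim F).+1)%N.
Proof.
move=> [[y0 y0F] [B BA FE]].
pose E i j := `[< exists k, in_range i j k /\ F `<=` diff_hyperplane i j k >].
pose e i j := E i j || E j i.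
have es : connect_sym e by apply: sym_connect_sym => i j; rewrite /e orbC.
have y0V : y0 \in V by move: y0F; rewrite FE => -[].
(* Along an equation of F the coordinates of [y0] differ by an integer, and their floors by the same
   one: [m] is an integer solution. *)
pose m i : int := Num.floor (y0 0 i).
have mE i j k : F `<=` diff_hyperplane i j k -> m i - m j = k.
  move=> /(_ _ y0F)[_] /eqP; rewrite subr_eq => /eqP.
  by rewrite /m => ->; rewrite floorDzr ?intr_int // intrKfloor addrK.
have [U [memU dimU]] := dim_sum0_components R n e es.
have FE' z : F z <-> z \in V /\ forall i j, E i j -> z 0 i - z 0 j = (m i - m j)%:~R.
  split=> [Fz|[zV zE]].
    split=> [|i j /asboolP[k [r Fk]]]; first by move: Fz; rewrite FE => -[].
    by rewrite (mE i j k Fk); have [] := Fk _ Fz.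
  rewrite FE; split=> // H BH; have [i [j [k [ij ak kb HE]]]] := BA _ BH.
  have FH : F `<=` diff_hyperplane i j k by rewrite FE -HE => u [_]; exact.
  rewrite HE; split=> //; rewrite -(mE i j k FH); apply: zE.
  by apply/asboolP; exists k; split.
have y0E := ((FE' y0).1 y0F).2.
have FU : F = translate y0 U.
  apply/seteqP; split=> z; rewrite /translate /= => h.
    have [zV zE] := (FE' z).1 h; apply/memU; split; first by rewrite rpredB.
    apply/(connect_constP _ _ es _ (fun i => (z - y0) 0 i)) => i j.
    rewrite !mxE => /orP[] eij; have := zE _ _ eij; rewrite -(y0E _ _ eij); lra.
  have [zV zU] := (memU _).1 h; apply/FE'; split.
    by rewrite -(subrK y0 z) rpredD.
  move=> i j eij; rewrite -(y0E _ _ eij).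
  have := (connect_constP _ _ es _ (fun i => (z - y0) 0 i)).2 zU i j.
  by rewrite !mxE /e eij => /(_ isT); lra.
rewrite FU aff_dim_translate dimU -(card_mod_system n.+1 q e m) //; last by lia.
rewrite -sum1_card big_mkcond /= [RHS]big_mkcond /=; apply: eq_bigr => x _.
rewrite inE -FU; set c := [forall i, _].
suff -> : `[< flat_mod x F >] = c by case: c.
apply/asboolP/idP => [h|/forallP h i j k r Fk].
  apply/forallP => i; apply/forallP => j; apply/implyP.
  case/orP => /asboolP[k [r Fk]]; have := h _ _ _ r Fk; rewrite /congr_at.
    by rewrite (mE _ _ _ Fk).
  by rewrite -(mE _ _ _ Fk) -rpredN; congr (_ %| _)%Z; ring.
have /implyP := forallP (h i) j; rewrite (mE _ _ _ Fk); apply.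
by rewrite /e /E; apply/orP; left; apply/asboolP; exists k.
Qed.

(** For each x the Moebius sum over the flats through it is 1 if its smallest flat is V and 0
    otherwise. *)
Lemma trunc_char_poly_count :
  q%:Z * (trunc_char_poly R n.+1 a b).[q%:Z] = (\sum_x `[< generic_mod x >])%:R.
Proof.
have finA := @finite_truncated_arrangement R n.+1 a%:Z b%:Z.
rewrite /trunc_char_poly /arr_char_poly horner_sum mulr_sumr.
rewrite (eq_big_seq (fun F =>
  \sum_x mobius P [set` V] F * (`[< flat_mod x F >])%:R)); last first.
  move=> F /(mem_intersection_poset _ F finA) FP.
  rewrite -mulr_sumr -natr_sum card_flat_mod // hornerZ hornerXn natrX exprS.
  by rewrite natz mulrCA.
rewrite exchange_big natr_sum /=; apply: eq_bigr => x _.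
have xP : (smallest_flat_mod x : (set 'rV[R]_n.+1)^d) \in P.
  by apply/mem_intersection_poset => //; exact: smallest_flat_flat.
transitivity (\sum_(F <- P | (F <= (smallest_flat_mod x : (set 'rV[R]_n.+1)^d))%O)
    mobius P [set` V] F).
  rewrite [RHS]big_mkcond; apply: eq_big_seq => F /(mem_intersection_poset _ F finA) FP.
  case: ifPn => [/le_intersection_poset/flat_modE h|/negP h].
    by rewrite (asboolT (h FP)) mulr1.
  rewrite asboolF ?mulr0 // => /(flat_modE _ _ FP) h'.
  exact/h/le_intersection_poset.
rewrite sum_mobius_le //; [|exact: mem_ambient|].
  congr ((nat_of_bool _)%:R : int); apply/idP/idP.
    by move/eqP/smallest_flat_generic/asboolP.
  by move/asboolP/smallest_flat_generic => ->.
move=> F /(mem_intersection_poset _ F finA) FP; apply/le_intersection_poset.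
by have [_ [C _ ->]] := FP; exact: subIsetl.
Qed.

End PointCount.

(** * The characteristic polynomial *)

(** With representatives in [0,q) and |k| < q, a multiple of q of the form x_i - x_j - k can only be
    -q, 0 or q. *)
Lemma generic_mod_well_spaced n a b q (x : {ffun 'I_n.+1 -> 'I_q}) :
  (a <= b)%N -> (0 < b)%N -> (a + b <= q)%N ->
  generic_mod n a b q x <-> well_spaced n.+1 q a b x.
Proof.
move=> ab b0 abq; split=> [g|W i j k [ij ak kb]].
  apply/forallP => i; apply/forallP => j; apply/implyP => ij.
  have {}g (k w : int) : - a%:Z + 1 <= k -> k <= b%:Z - 1 ->
      (x i)%:Z - (x j)%:Z - k = w * q%:Z -> false.
    move=> ak kb e; have := g i j k (And3 ij ak kb).
    by move/negP; case; apply/dvdzP; exists w.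
  have := ltn_ord (x i); have := ltn_ord (x j).
  move: (nat_of_ord (x i)) (nat_of_ord (x j)) g => u v g vq uq.
  case: leqP => uv; apply/andP; split; rewrite leqNgt; apply/negP => lt.
  - by have := g (u%:Z - v%:Z) 0; lia.
  - by have := g (u%:Z - v%:Z + q%:Z) (-1); lia.
  - by have := g (u%:Z - v%:Z) 0; lia.
  - by have := g (u%:Z - v%:Z - q%:Z) 1; lia.
apply/negP => /dvdzP[w].
have := implyP (forallP (forallP W i) j) ij.
have := ltn_ord (x i); have := ltn_ord (x j).
move: (nat_of_ord (x i)) (nat_of_ord (x j)) => u v vq uq h e.
have {e} : [\/ u%:Z - v%:Z - k = - q%:Z, u%:Z - v%:Z = k | u%:Z - v%:Z - k = q%:Z].
  have : [\/ w = -1, w = 0 | w = 1].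
    have : (-2 < w) && (w < 2) by apply/andP; split; nia.
    by move: w {e} => [[|[|w]]|[|w]] ?; [constructor 2|constructor 3|lia|constructor 1|lia].
  by case=> wE; rewrite wE in e; [constructor 1|constructor 2|constructor 3]; lia.
by move: h; case: leqP => uv /andP[h1 h2] []; lia.
Qed.

Lemma generic_mod_shift n a b q (x : {ffun 'I_n.+1 -> 'I_q.+1}) (t : 'I_q.+1) :
  generic_mod n a b q.+1 (x + [ffun=> t]) <-> generic_mod n a b q.+1 x.
Proof.
suff E i j k : congr_at n q.+1 (x + [ffun=> t]) i j k = congr_at n q.+1 x i j k.
  by split=> g i j k /g; rewrite E.
rewrite /congr_at !ffunE /=.
have D (u : nat) : (u %% q.+1)%N%:Z = u%:Z - (u %/ q.+1)%N%:Z * q.+1%:Z.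
  by have := divn_eq u q.+1; lia.
rewrite !D !PoszD; move: (_ %/ _)%N (_ %/ _)%N => u v.
have dv : (q.+1%:Z %| (u%:Z - v%:Z) * q.+1%:Z)%Z by exact: dvdz_mull.
by rewrite -[RHS](rpredDr _ dv); congr (_ %| _)%Z; ring.
Qed.

(** Translation by (t, ..., t) identifies the solutions with x_0 = 0 and those with x_0 = t. *)
Lemma sum_well_spaced n a b q : (a <= b)%N -> (0 < b)%N -> (a + b <= q)%N ->
  (\sum_(x : {ffun 'I_n.+1 -> 'I_q}) `[< generic_mod n a b q x >] =
   q * based_count n q a b)%N.
Proof.
case: q => [|q]; first by lia.
move=> ab b0 abq; rewrite (partition_big (fun x : {ffun _ -> _} => x ord0) xpredT) //=.
rewrite -[X in (X * _)%N]card_ord -sum_nat_const; apply: eq_bigr => t _.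
rewrite (reindex_inj (addIr [ffun=> t])) /=; apply: eq_big => x.
  by rewrite !ffunE -subr_eq0 addrK.
move=> _; congr nat_of_bool; apply/asboolP/idP.
  by move/generic_mod_shift/generic_mod_well_spaced; apply.
by move/generic_mod_well_spaced => /(_ ab b0 abq) /generic_mod_shift.
Qed.

(** Reversing the coordinates replaces k by -k. *)
Lemma sum_generic_mod_rev n a b q :
  (\sum_(x : {ffun 'I_n.+1 -> 'I_q}) `[< generic_mod n a b q x >] =
   \sum_(x : {ffun 'I_n.+1 -> 'I_q}) `[< generic_mod n b a q x >])%N.
Proof.
pose h (x : {ffun 'I_n.+1 -> 'I_q}) := [ffun i => x (rev_ord i)].
have hK : involutive h by move=> x; apply/ffunP => i; rewrite !ffunE rev_ordK.
have rev c d x : generic_mod n c d q x -> generic_mod n d c q (h x).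
  move=> g i j k [ij ck kd]; rewrite /congr_at -rpredN !ffunE.
  have : in_range n c d (rev_ord j) (rev_ord i) (- k).
    by split=> /=; [have := ltn_ord j; lia|lia|lia].
  by move/g; congr (~~ (_ %| _)%Z); ring.
rewrite (reindex_inj (inv_inj hK)); apply: eq_bigr => x _; congr nat_of_bool.
by apply/asboolP/asboolP => /rev; rewrite ?hK.
Qed.

Lemma eq_poly_nat (F : numDomainType) (p r : {poly F}) N :
  (forall q : nat, (N <= q)%N -> p.[q%:R] = r.[q%:R]) -> p = r.
Proof.
move=> h; apply/eqP; rewrite -subr_eq0; apply/eqP.
apply: (@roots_geq_poly_eq0 _ _ [seq (N + i)%:R | i <- iota 0 (size (p - r))]).
- apply/allP => _ /mapP[i _ ->]; rewrite /root hornerD hornerN h ?leq_addr //.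
  by rewrite subrr.
- rewrite map_inj_uniq ?iota_uniq // => i j /eqP.
  by rewrite eqr_nat eqn_add2l => /eqP.
- by rewrite size_map size_iota.
Qed.

(** The Postnikov-Stanley formula, with [lo] = min(a,b) and [k] = |a - b|. *)
Lemma trunc_char_poly_residue_sum (R : realType) n (a b lo k : nat) : (0 < k)%N ->
  (a == lo) && (b == lo + k)%N || (b == lo) && (a == lo + k)%N ->
  (k ^ n.+1)%:R *: trunc_char_poly R n.+1 a b =
  residue_sum k n.+1 (fun j => ('X - (lo * n.+1)%:R) ^+ n \Po ('X - j%:R)).
Proof.
(* The threshold adds up what lifting modulo q and the closed count each require. *)
move=> k0 ab; apply: (eq_poly_nat _ _ _ (n.+1 * (a + b) + lo * n.+1 + n.+2 * k).+1) => q qge.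
have q0 : q%:Z != 0 by lia.
have qab : (n.+1 * (a + b) < q)%N by lia.
have count : (trunc_char_poly R n.+1 a b).[q%:R] = (based_count n q lo (lo + k))%:R.
  apply: (mulfI q0); rewrite natz trunc_char_poly_count //.
  have -> : (\sum_x `[< generic_mod n a b q x >] =
      \sum_x `[< generic_mod n lo (lo + k) q x >])%N.
    by case/orP: ab => /andP[/eqP -> /eqP ->] //; exact: sum_generic_mod_rev.
  rewrite sum_well_spaced ?natrM ?natz ?leq_addr //; first by lia.
  by case/orP: ab => /andP[/eqP e1 /eqP e2]; subst; nia.
rewrite hornerZ count based_count_formula //; last by lia.
rewrite -[RHS]/(horner_eval (q%:R : int) _) -residue_sum_morph.
apply: eq_residue_sum => j _.
rewrite -[RHS]/((_ \Po ('X - j%:R)).[q%:R]) horner_comp horner_exp.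
by congr (_ ^+ n); rewrite !hornerE -!polyC_natr !hornerE; ring.
Qed.

Lemma Re_natr (R : realType) (m : nat) : complex.Re (m%:R : R[i]) = m%:R.
Proof. by rewrite -(rmorph_nat (real_complex R)). Qed.

(** Conjugation fixes the integer coefficients; divisibility by powers gives one inequality, and
    applying it to z and its conjugate gives both. *)
Lemma mup_conj (R : realType) (p : {poly int}) (z : R[i]) :
  let r := map_poly intr p in r != 0 -> mup (z^*)%C r = mup z r.
Proof.
move=> r r0.
have rJ : map_poly conjc r = r.
  by rewrite /r -map_poly_comp; apply: eq_map_poly => m /=; rewrite rmorph_int.
have le (w : R[i]) : (mup w r <= mup (w^*)%C r)%N.
  have dv : ('X - w%:P) ^+ mup w r %| r by rewrite -mup_geq.
  have XJ : map_poly conjc (('X - w%:P) ^+ mup w r) = ('X - (w^*)%C%:P) ^+ mup w r.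
    by rewrite rmorphXn rmorphB /= map_polyX map_polyC.
  by rewrite (mup_geq _ _ r0) -XJ -[X in _ %| X]rJ (dvdp_map conjc).
have lez := le z; have := le (z^*)%C; rewrite conjcK => leJ.
apply/eqP; rewrite eqn_leq; apply/andP; split; [exact: leJ | exact: lez].
Qed.

Theorem theorem9p11 (R : realType) (a b : int) (n : nat) :
  0 <= a -> 0 <= b -> 2 <= a + b -> a <> b -> (1 <= n)%N ->
  let p : {poly R[i]} := map_poly (fun m : int => m%:~R) (trunc_char_poly R n a b) in
  (forall z : R[i], root p z ->
     complex.Re z = ((a + b - 1) * n%:Z)%:~R / 2) /\
  (forall z : R[i], mup (((a + b - 1) * n%:Z)%:~R - z) p = mup z p).
Proof.
case: a b n => [a|//] [b|//] [//|n] _ _ ab2 ab _ p; set N := (_ * _ : int).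
(* As a + b - 1 = 2 lo + (k - 1), N/2 is the starting line lo (n+1) plus (k-1)/2 for each of the n +
   1 operator factors. *)
have [lo [k [k0 lok NE]]] : exists lo k : nat, [/\ (0 < k)%N,
    (a == lo) && (b == lo + k)%N || (b == lo) && (a == lo + k)%N
    & N = (lo * n.+1).*2%:Z + (n.+1 * k.-1)%:Z].
  have [lt|lt|e] := ltngtP a b; last by rewrite e in ab.
    by exists a, (b - a)%N; split; [lia|lia|rewrite /N; nia].
  by exists b, (a - b)%N; split; [lia|lia|rewrite /N; nia].
pose f : {poly R[i]} := ('X - (lo * n.+1)%:R) ^+ n.
have f0 : f != 0 by rewrite expf_neq0 // -polyC_natr polyXsubC_eq0.
have f_line : roots_on_line R (lo * n.+1)%:R f.
  (* For exponent 0, f = 1 has no root. *)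
  move=> z; rewrite /f; case: (n) => [|m]; first by rewrite expr0 (negPf (root1 _)).
  by rewrite -polyC_natr root_exp_XsubC => /eqP ->; rewrite Re_natr.
have [h0 h_line] := residue_sum_line R k n.+1 _ f k0 f0 f_line.
set h := residue_sum _ _ _ in h0 h_line.
have hE : (k ^ n.+1)%:R *: p = h.
  have /(congr1 (map_poly (intr : int -> R[i]))) :=
    trunc_char_poly_residue_sum R n a b lo k k0 lok.
  rewrite map_polyZ rmorph_nat => ->.
  apply: etrans (esym (residue_sum_morph k _ _ (map_poly (intr : int -> R[i])) _ _)) _.
  apply: eq_residue_sum => j _ /=.
  by rewrite map_comp_poly rmorphXn !rmorphB /= !map_polyX !rmorph_nat.
have kn0 : (k ^ n.+1)%:R != 0 :> R[i] by rewrite pnatr_eq0 expn_eq0; lia.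
have p_line z : root p z -> complex.Re z = N%:~R / 2.
  move=> pz; rewrite NE intrD (h_line z) -?hE ?rootZ //.
  by rewrite -!pmulrn -muln2 natrM; lra.
split; first exact: p_line.
move=> z.
(* On the line N - z is the conjugate of z; off the line neither is a root. *)
have [zN|zN] := eqVneq (complex.Re z) (N%:~R / 2).
  have -> : N%:~R - z = (z^*)%C.
    apply/eqP; rewrite eq_complex -(rmorph_int (real_complex R)) /=.
    case: z zN => x y /= ->; rewrite sub0r eqxx andbT; apply/eqP; lra.
  by apply: mup_conj; apply: contraNneq h0 => p0; rewrite -hE [p]p0 scaler0.
rewrite !mupNroot //; apply/negP => /p_line.
  by move/eqP; apply/negP.
rewrite -(rmorph_int (real_complex R)); case: z zN => x y /= zN e.
by move/eqP: zN; apply; lra.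
Qed.
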